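(* For every $n\ge1$, the number of elements of $C_2\wr S_n$ that simultaneously bi-avoid $(1\text{-}2,0~0)$ and $(1\text{-}2,0~1)$ equals the Catalan number $C_{n+1}=\frac{1}{n+2}\binom{2n+2}{n+1}$.
   Context: $C_2\wr S_n$ denotes the set of pairs $(\sigma,w)$ where $\sigma=\sigma_1\cdots\sigma_n$ is a permutation of $\{1,\dots,n\}$ in one-line notation and $w=w_1\cdots w_n\in\{0,1\}^n$. $(\sigma,w)$ bi-avoids $(1\text{-}2,0~0)$ if there are no indices $i<j$ with $\sigma_i<\sigma_j$ and $w_i=w_j$; it bi-avoids $(1\text{-}2,0~1)$ if there are no indices $i<j$ with $\sigma_i<\sigma_j$ and $w_i<w_j$ (i.e. $w_i=0,w_j=1$). *)

(* Defs.v *)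
From mathcomp Require Import all_boot all_fingroup all_algebra.

Set Implicit Arguments.
Unset Strict Implicit.
Unset Printing Implicit Defensive.

(* Underlying set of the wreath product C_2 wr S_n; the group law plays no
   role. Positions and values are shifted from {1, ..., n} to {0, ..., n-1},
   and the entry sigma_i of the one-line notation is [x.1 i]. *)
Definition C2wrS (n : nat) : finType := ('S_n * {ffun 'I_n -> 'I_2})%type.

(* The pattern (1-2, 0 0): the letters are compared only with each other, so
   the equal signs w_i = w_j may be both 0 or both 1. *)
Definition biavoids_12_00 (n : nat) (x : C2wrS n) : bool :=
  ~~ [exists i : 'I_n, exists j : 'I_n,
       [&& i < j, x.1 i < x.1 j & x.2 i == x.2 j]].

Definition biavoids_12_01 (n : nat) (x : C2wrS n) : bool :=
  ~~ [exists i : 'I_n, exists j : 'I_n,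
       [&& i < j, x.1 i < x.1 j & x.2 i < x.2 j]].

(* Rational-valued, so that the division is exact by construction. *)
Definition catalan (m : nat) : rat :=
  ((m.+1)%:R^-1 * 'C((2 * m)%N, m)%:R)%R.

(* Main.v *)
Require Import Defs.
From mathcomp Require Import all_boot all_fingroup all_algebra.
From mathcomp Require Import zify.

(* Together the two conditions say that every non-inversion i < j of sigma has
   w_i = 1 and w_j = 0. In particular sigma is decreasing on each of the two
   sign classes, so (sigma, w) is determined by w and the word u listing the
   signs by decreasing value. The pairs (w, u) that occur are exactly those for
   which every prefix of u has at most as many 1s as the same prefix of w, with
   equality for the full words. Reading the letters (w_i, u_i) as steps
   w_i - u_i, these are Motzkin paths with two colours of flat steps, which are
   counted by the reflection principle. *)

Set Implicit Arguments.
Unset Strict Implicit.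
Unset Printing Implicit Defensive.

(** * Occurrences of a letter in a prefix of a word *)

(** At [m = i] and [b = w i] this is the rank, counted from 0, of position [i] among the positions
    carrying its letter. *)
Definition prefix_count n (T : eqType) (w : 'I_n -> T) (b : T) (m : nat) : nat :=
  \sum_(i < n) ((i < m) && (w i == b)).

Lemma prefix_countE n (T : eqType) (w : 'I_n -> T) b m :
  prefix_count w b m = #|[set i : 'I_n | (i < m) && (w i == b)]|.
Proof.
rewrite /prefix_count -sum1_card [RHS]big_mkcond /=; apply: eq_bigr => i _.
by rewrite inE; case: andb.
Qed.

Lemma leq_prefix_count n (T : eqType) (w : 'I_n -> T) b m1 m2 :
  m1 <= m2 -> prefix_count w b m1 <= prefix_count w b m2.
Proof.
move=> le_m; apply: leq_sum => i _.
by case: (ltnP i m1) => //= lt_im; rewrite (leq_trans lt_im le_m).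
Qed.

Lemma prefix_count_ltn n (T : eqType) (w : 'I_n -> T) (i : 'I_n) m :
  i < m -> prefix_count w (w i) i < prefix_count w (w i) m.
Proof.
move=> lt_im; rewrite /prefix_count (bigD1 i) //= [X in _ < X](bigD1 i) //=.
rewrite ltnn lt_im eqxx /= add0n add1n ltnS; apply: leq_sum => j _.
by case: (ltnP j i) => //= lt_ji; rewrite (ltn_trans lt_ji lt_im).
Qed.

Lemma prefix_count_last n (T : eqType) (w : 'I_n -> T) (i : 'I_n) :
  prefix_count w (w i) i.+1 = (prefix_count w (w i) i).+1.
Proof.
rewrite /prefix_count (bigD1 i) //= [in RHS](bigD1 i) //=.
rewrite ltnn ltnSn eqxx /= add0n add1n; congr _.+1; apply: eq_bigr => j neq_ji.
by rewrite ltnS leq_eqVlt (inj_eq val_inj) (negPf neq_ji).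
Qed.

Lemma prefix_count_inj n (T : eqType) (w : 'I_n -> T) (i j : 'I_n) :
  w i = w j -> prefix_count w (w i) i = prefix_count w (w j) j -> i = j.
Proof.
move=> eq_w eq_c; apply: val_inj => /=.
case: (ltngtP i j) => // /(prefix_count_ltn w).
  by rewrite {2}eq_w eq_c ltnn.
by rewrite -{2}eq_w eq_c ltnn.
Qed.

(** The positions of [b] have distinct ranks, all below the number of these positions, so by
    pigeonhole every such rank is attained. *)
Lemma prefix_count_onto n (T : eqType) (w : 'I_n -> T) b k :
  k < prefix_count w b n -> exists2 i, w i = b & prefix_count w b i = k.
Proof.
set A := [set i : 'I_n | w i == b].
have -> : prefix_count w b n = #|A|.
  by rewrite prefix_countE; apply: eq_card => i; rewrite !inE ltn_ord.
move=> lt_k.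
have [|||_ /(_ k)] := @uniq_min_size _
    [seq prefix_count w b i | i : 'I_n <- enum A] (iota 0 #|A|).
- rewrite map_inj_in_uniq ?enum_uniq // => i j.
  rewrite !mem_enum !inE => /eqP wi /eqP wj eq_c.
  by apply: (@prefix_count_inj _ _ w); rewrite ?wi ?wj.
- move=> _ /mapP[i + ->]; rewrite mem_enum inE mem_iota add0n => /eqP wi /=.
  have := prefix_count_ltn w (ltn_ord i); rewrite wi [X in _ < X]prefix_countE.
  move=> lt_c; apply: leq_trans lt_c _.
  by apply: subset_leq_card; apply/subsetP => j; rewrite !inE => /andP[].
- by rewrite size_map size_iota -cardE.
rewrite mem_iota add0n lt_k => /mapP[i].
by rewrite mem_enum inE => /eqP wi ->; exists i.
Qed.

Lemma prefix_count_binary n (w : 'I_n -> 'I_2) m :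
  prefix_count w ord0 m + prefix_count w ord_max m = \sum_(i < n) (i < m).
Proof.
rewrite -big_split; apply: eq_bigr => i _ /=.
by case: (i < m) => //=; case: (w i) => [[|[|//]] ?].
Qed.

(** * Avoidance and dominated pairs of words *)

Lemma prefix_count_comp n (T : eqType) (s : 'I_n -> 'I_n) (w u : 'I_n -> T) b m :
  injective s -> (forall i, u (s i) = w i) ->
  prefix_count u b m = #|[set i : 'I_n | (s i < m) && (w i == b)]|.
Proof.
move=> inj_s us; rewrite prefix_countE -[RHS](card_imset _ inj_s); apply: eq_card => v.
have [t st ts] := injF_bij inj_s.
apply/idP/imsetP => [|[i + ->]]; rewrite !inE ?us // -{1 2}[v]ts us => Hv.
by exists (t v); rewrite ?inE ?ts // -{1}[v]ts.
Qed.

(** Every 1 that [s] sends before [m] already stands before [m]. Otherwise its position [j]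
    satisfies [s j < m <= j]; as [s] is a bijection, some [i] has [i < m <= s i], and avoidance for
    [i < j] contradicts [w j = 1]. *)
Lemma avoid_dominated n (s : 'I_n -> 'I_n) (w u : 'I_n -> 'I_2) m :
  injective s -> (forall i, u (s i) = w i) ->
  (forall i j : 'I_n, i < j -> s j < s i -> w j < w i) ->
  prefix_count u ord_max m <= prefix_count w ord_max m.
Proof.
move=> inj_s us av; rewrite (prefix_count_comp _ _ inj_s us) prefix_countE.
apply: subset_leq_card; apply/subsetP => j; rewrite !inE => /andP[lt_sj /eqP wj].
rewrite wj eqxx andbT ltnNge; apply/negP => le_mj.
pose A := [set i : 'I_n | i < m]; pose B := [set i : 'I_n | s i < m].
have eqAB : #|B| = #|A|.
  rewrite -[LHS](card_imset _ inj_s); apply: eq_card => v.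
  have [t st ts] := injF_bij inj_s.
  apply/imsetP/idP => [[i + ->]|]; rewrite !inE // => lt_v.
  by exists (t v); rewrite ?inE ts.
have /subsetPn[i] : ~~ (A \subset B).
  apply/negP => sAB; have /eqP eqS : A == B by rewrite eqEcard sAB eqAB /=.
  have : j \in B by rewrite inE.
  by rewrite -eqS inE ltnNge le_mj.
rewrite !inE -leqNgt => lt_im le_ms.
have := av i j (leq_trans lt_im le_mj) (leq_trans lt_sj le_ms).
by rewrite wj; case: (w i) => [[|[|//]] ?].
Qed.

(** The map [s] sends the k-th occurrence of each letter in [w] to the k-th occurrence of the same
    letter in [u]. *)
Lemma dominated_ex n (w u : 'I_n -> 'I_2) :
  (forall m, m <= n -> prefix_count u ord_max m <= prefix_count w ord_max m) ->
  prefix_count w ord_max n = prefix_count u ord_max n ->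
  exists s : 'I_n -> 'I_n, [/\ injective s, forall i, u (s i) = w i &
    forall i j : 'I_n, i < j -> s j < s i -> w j < w i].
Proof.
move=> dom tot.
have tot0 b : prefix_count w b n = prefix_count u b n.
  have := prefix_count_binary w n; rewrite -(prefix_count_binary u n) tot.
  move=> /addIn eq0; case: b => [[|[|//]] lt_b].
    by rewrite (_ : Ordinal lt_b = ord0) //; apply: val_inj.
  by rewrite (_ : Ordinal lt_b = ord_max) //; apply: val_inj.
have /fin_all_exists[s sP] i : exists v, u v = w i /\
    prefix_count u (w i) v = prefix_count w (w i) i.
  have [|v uv cv] := @prefix_count_onto _ _ u (w i) (prefix_count w (w i) i).
    by rewrite -tot0 prefix_count_ltn.
  by exists v.
have us i : u (s i) = w i by case: (sP i).
have cs i : prefix_count u (w i) (s i) = prefix_count w (w i) i by case: (sP i).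
exists s; split=> // [i j eq_s|i j lt_ij lt_s].
  have eq_w : w i = w j by rewrite -!us eq_s.
  by apply: (@prefix_count_inj _ _ w) => //; rewrite -!cs eq_s eq_w.
rewrite ltnNge; apply/negP => le_w.
(* On equal letters [s] is increasing, so the only case left to refute is [w i = 0], [w j = 1]. *)
have [eq_w|neq_w] := eqVneq (w i) (w j).
  have := prefix_count_ltn w lt_ij; have := prefix_count_ltn u lt_s.
  by rewrite us -{1}eq_w -eq_w cs {1}eq_w cs -eq_w => /ltn_trans H /H; rewrite ltnn.
have wi : w i = ord0.
  by apply: val_inj; move: le_w neq_w; case: (w i) (w j) => [[|[|//]] ?] [[|[|//]] ?].
have wj : w j = ord_max.
  by apply: val_inj; move: le_w neq_w; case: (w i) (w j) => [[|[|//]] ?] [[|[|//]] ?].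
(* Domination up to and including place [s j] forces [j <= s j], so this prefix of [w] contains [i].
   Since [s i] lies beyond the prefix, [w] has more 0s there than [u], and at least as many 1s,
   which is impossible for equal lengths. *)
have := dom (s j).+1 (ltn_ord _).
have := prefix_count_last u (s j); rewrite us cs wj => -> le1.
have lt_jm : j <= s j.
  rewrite leqNgt; apply/negP => /(leq_prefix_count w ord_max).
  by move=> /(leq_trans le1); rewrite ltnn.
have lt_im : i < (s j).+1 by rewrite ltnS (leq_trans (ltnW lt_ij)).
have := prefix_count_ltn w lt_im; have := leq_prefix_count u ord0 lt_s.
rewrite -wi cs wi.
have := prefix_count_binary w (s j).+1; rewrite -(prefix_count_binary u (s j).+1).
have := prefix_count_last u (s j); rewrite us cs wj => ->.
by lia.
Qed.

(** * Counting dominated pairs *)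

(* [h] is the excess of 1s that the first word starts with. *)
Definition dominated n h (f : {ffun 'I_n -> 'I_2 * 'I_2}) : bool :=
  let w := fun i => (f i).1 in let u := fun i => (f i).2 in
  [forall m : 'I_n.+1,
     prefix_count u ord_max m <= h + prefix_count w ord_max m] &&
  (h + prefix_count w ord_max n == prefix_count u ord_max n).

Definition ffun_cons n (T : Type) (x : T) (f : {ffun 'I_n -> T}) :
    {ffun 'I_n.+1 -> T} := [ffun i => oapp f x (unlift ord0 i)].

Lemma ffun_cons0 n T (x : T) (f : {ffun 'I_n -> T}) : ffun_cons x f ord0 = x.
Proof. by rewrite ffunE unlift_none. Qed.

Lemma ffun_consS n T (x : T) (f : {ffun 'I_n -> T}) i :
  ffun_cons x f (lift ord0 i) = f i.
Proof. by rewrite ffunE liftK. Qed.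

Lemma card_ffun_cons n (T : finType) (P : pred {ffun 'I_n.+1 -> T}) :
  #|[set f | P f]| = \sum_x #|[set f : {ffun 'I_n -> T} | P (ffun_cons x f)]|.
Proof.
under eq_bigr do rewrite -sum1dep_card.
rewrite pair_big_dep /= -sum1dep_card.
pose tl (f : {ffun 'I_n.+1 -> T}) : {ffun 'I_n -> T} :=
  [ffun i : 'I_n => f (lift ord0 i)].
rewrite (reindex (fun p : T * {ffun 'I_n -> T} => ffun_cons p.1 p.2)) //=.
exists (fun f : {ffun 'I_n.+1 -> T} => (f ord0, tl f)) => [[x f] _|f _] /=.
  rewrite ffun_cons0; congr pair; apply/ffunP => i.
  by rewrite ffunE ffun_consS.
apply/ffunP => i; case: (unliftP ord0 i) => [j ->|->]; last by rewrite ffun_cons0.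
by rewrite ffun_consS ffunE.
Qed.

Lemma prefix_count0 n (T : eqType) (w : 'I_n -> T) b : prefix_count w b 0 = 0.
Proof. by apply: big1. Qed.

Lemma prefix_countS n (T : eqType) (w : 'I_n.+1 -> T) b m :
  prefix_count w b m.+1 =
    (w ord0 == b) + prefix_count (fun i => w (lift ord0 i)) b m.
Proof. by rewrite /prefix_count big_ord_recl. Qed.

Lemma eq_prefix_count n (T : eqType) (w1 w2 : 'I_n -> T) b m :
  w1 =1 w2 -> prefix_count w1 b m = prefix_count w2 b m.
Proof. by move=> eq_w; apply: eq_bigr => i _; rewrite eq_w. Qed.

(** The condition [x.2 <= h + x.1] is domination at the prefix of length 1; it also makes the
    truncated subtraction exact. *)
Lemma dominated_cons n h (x : 'I_2 * 'I_2) (f : {ffun 'I_n -> 'I_2 * 'I_2}) :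
  dominated h (ffun_cons x f) =
    (x.2 <= h + x.1) && dominated (h + x.1 - x.2) f.
Proof.
have val1 (b : 'I_2) : (b == ord_max) = b :> nat by case: b => [[|[|//]] ?].
have E1 m : prefix_count (fun i => (ffun_cons x f i).1) ord_max m.+1 =
    x.1 + prefix_count (fun i => (f i).1) ord_max m.
  rewrite prefix_countS ffun_cons0 val1; congr (_ + _).
  by apply: eq_prefix_count => i; rewrite ffun_consS.
have E2 m : prefix_count (fun i => (ffun_cons x f i).2) ord_max m.+1 =
    x.2 + prefix_count (fun i => (f i).2) ord_max m.
  rewrite prefix_countS ffun_cons0 val1; congr (_ + _).
  by apply: eq_prefix_count => i; rewrite ffun_consS.
rewrite /dominated E1 E2; apply/andP/and3P => [[/forallP dom /eqP tot]|].
  have le0 : x.2 <= h + x.1.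
    by have := dom (lift ord0 ord0); rewrite lift0 E1 E2 !prefix_count0 !addn0.
  split=> //; last by rewrite addnBAC // -addnA tot addKn.
  apply/forallP => m; have := dom (lift ord0 m).
  by rewrite lift0 E1 E2 addnBAC // addnA leq_subRL ?(leq_trans le0) ?leq_addr.
case=> le0 /forallP dom tot; split.
  apply/forallP => m; case: (unliftP ord0 m) => [k ->|->].
    have := dom k.
    by rewrite lift0 E1 E2 addnBAC // addnA leq_subRL ?(leq_trans le0) ?leq_addr.
  by rewrite prefix_count0.
move: tot; rewrite addnBAC // addnA => /eqP <-.
by rewrite subnKC ?(leq_trans le0) ?leq_addr.
Qed.

(** Pascal's rule applied twice. *)
Lemma bin_double_succ n k :
  'C(2 * n.+1, k.+2) = 'C(2 * n, k.+2) + 2 * 'C(2 * n, k.+1) + 'C(2 * n, k).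
Proof. by rewrite mulnS !binS; lia. Qed.

(** At the centre the two outer terms of the double Pascal rule coincide by symmetry. *)
Lemma bin_double_mid n :
  'C(2 * n.+1, n.+1) = 2 * 'C(2 * n, n.+1) + 2 * 'C(2 * n, n).
Proof.
case: n => // n; rewrite bin_double_succ.
have <- := @bin_sub (2 * n.+1) n; last by lia.
rewrite (_ : 2 * n.+1 - n = n.+2); lia.
Qed.

(* The reflection principle: replacing each letter (a, b) by the two unit steps
   2a - 1, 1 - 2b gives simple walks of length 2n from 2h to 0 that stay above
   -2; the reflected walks from 2h to -4 are subtracted. *)
Lemma card_dominated n h :
  #|[set f : {ffun 'I_n -> 'I_2 * 'I_2} | dominated h f]| + 'C(2 * n, n + h + 2)
  = 'C(2 * n, n + h).
Proof.
(* Removing the first letter keeps [h] for the two flat letters, raises it for (1, 0) and lowers it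
   for (0, 1), matching the weights 2, 1, 1 of the double Pascal rule. *)
elim: n h => [|n IHn] h.
  rewrite !add0n addn2 addn0 bin0n.
  have -> : [set f : {ffun 'I_0 -> 'I_2 * 'I_2} | dominated h f] =
            if h == 0 then setT else set0.
    apply/setP => f; rewrite inE /dominated.
    have E w : @prefix_count 0 _ w (@ord_max 1) =1 fun _ => 0.
      by move=> m; rewrite /prefix_count big_ord0.
    rewrite !E addn0; case: eqP => [->|_]; rewrite ?inE ?andbF // andbT.
    by apply/forallP => m; rewrite !E.
  by case: eqP; rewrite ?cards0 ?cardsT ?card_ffun ?card_ord.
rewrite card_ffun_cons; under eq_bigr do under eq_finset do rewrite dominated_cons.
rewrite (eq_bigr (fun x : 'I_2 * 'I_2 => (x.2 <= h + x.1) *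
  #|[set f : {ffun 'I_n -> 'I_2 * 'I_2} | dominated (h + x.1 - x.2) f]|)); last first.
  move=> x _; case: (x.2 <= _) => /=; rewrite ?mul1n ?mul0n //.
  by apply/eqP; rewrite cards_eq0; apply/eqP/setP => f; rewrite !inE.
rewrite -(pair_bigA _ (fun a b : 'I_2 => (b <= h + a) *
  #|[set f : {ffun 'I_n -> 'I_2 * 'I_2} | dominated (h + a - b) f]|)) /=.
rewrite !big_ord_recl !big_ord0 /= (_ : bump 0 0 = 1) // !addn0 !subn0 addnK.
rewrite addn1 subn1 !mul1n /=.
(* At [h = 0] the letter (0, 1) is forbidden; the difference of binomials it would contribute
   vanishes by symmetry. *)
case: h => [|h] /=.
  have := IHn 0; have := IHn 1.
  rewrite mul0n !addn0 addn1 !addn2 bin_double_succ bin_double_mid.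
  move: #|_| #|_| => M1 M0; lia.
have := IHn h; have := IHn h.+1; have := IHn h.+2.
rewrite mul1n !addn2 !addnS !addSn !bin_double_succ.
move: #|_| #|_| #|_| => M1 M0 M2; lia.
Qed.

Lemma catalan_bin n :
  catalan n.+1 = ('C(2 * n, n)%:R - 'C(2 * n, n + 2)%:R)%R.
Proof.
have e1 : n.+1 * 'C(2 * n, n.+1) = n * 'C(2 * n, n).
  by rewrite mul_bin_left mulSn mul1n addKn.
have e2 : n.+2 * 'C(2 * n, n.+2) = n.-1 * 'C(2 * n, n.+1).
  by rewrite mul_bin_left; congr (_ * _); lia.
(* The claim multiplied by [n + 2], stated additively in the natural numbers. The case [n = 0] is
   separate because of [n.-1] in [e2]. *)
have e4 : n.+2 * 'C(2 * n, n.+2) + 'C(2 * n.+1, n.+1) = n.+2 * 'C(2 * n, n).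
  rewrite e2 bin_double_mid; case: n e1 {e2} => [|n] e1; first by rewrite bin0.
  by move: e1 => /=; nia.
rewrite /catalan addn2.
have {}e4 : (n.+2%:R * 'C(2 * n, n.+2)%:R + 'C(2 * n.+1, n.+1)%:R
  = n.+2%:R * 'C(2 * n, n)%:R :> rat)%R by rewrite -!GRing.natrM -GRing.natrD e4.
have nz : (n.+2%:R != 0 :> rat)%R by rewrite Num.Theory.pnatr_eq0.
apply: (GRing.mulfI nz); rewrite GRing.mulrA GRing.divff // GRing.mul1r.
by rewrite GRing.mulrBr -e4 GRing.addrC GRing.addKr.
Qed.

(** * The bijection with dominated pairs *)

Theorem theorem10 (n : nat) (hn : 1 <= n) :
  (#|[set x : C2wrS n | biavoids_12_00 x && biavoids_12_01 x]|%:R)%R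
  = catalan n.+1.
Proof.
(* [tau x i] is the place of the value at [i] when values are listed in decreasing order, so
   non-inversions of the permutation become inversions of [tau x]. *)
pose tau (x : C2wrS n) i := rev_ord (x.1 i).
pose Phi (x : C2wrS n) : {ffun 'I_n -> 'I_2 * 'I_2} :=
  [ffun v => (x.2 v, x.2 ((x.1^-1)%g (rev_ord v)))].
have inj_tau x : injective (tau x) by move=> i j /rev_ord_inj /perm_inj.
have Phi_tau x i : (Phi x (tau x i)).2 = (Phi x i).1.
  by rewrite !ffunE /= rev_ordK permK.
have tau_lt x i j : (tau x j < tau x i) = (x.1 i < x.1 j).
  by rewrite /tau /=; case: (x.1 i) (x.1 j) => [a lt_a] [b lt_b] /=; lia.
pose av x := forall i j : 'I_n, i < j -> tau x j < tau x i -> x.2 j < x.2 i.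
have avP x : reflect (av x) (biavoids_12_00 x && biavoids_12_01 x).
  rewrite -negb_or; apply: (iffP idP) => [nex i j lt_ij|avx].
    rewrite tau_lt => lt_s; rewrite ltnNge leq_eqVlt; apply: contra nex.
    by case/orP=> H; apply/orP; [left|right]; apply/existsP; exists i;
      apply/existsP; exists j; rewrite lt_ij lt_s.
  apply/norP; split; apply/negP => /existsP[i /existsP[j /and3P[lt_ij]]];
    rewrite -tau_lt => /(avx _ _ lt_ij) lt_w.
    by move/eqP=> eq_w; rewrite eq_w ltnn in lt_w.
  by move/(ltn_trans lt_w); rewrite ltnn.
have inj_Phi : {in [set x | biavoids_12_00 x && biavoids_12_01 x] &, injective Phi}.
  move=> x y; rewrite !inE => /avP avx /avP avy eqPhi.
  (* Avoidance makes [tau z] increasing on each sign class, so it preserves ranks within the class;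
     hence [Phi z] determines [tau z]. *)
  have count_tau z : av z -> forall i,
      prefix_count (fun v => (Phi z v).2) (z.2 i) (tau z i) =
      prefix_count (fun v => (Phi z v).1) (z.2 i) i.
    move=> avz i; rewrite (prefix_count_comp _ _ (inj_tau z) (Phi_tau z)).
    rewrite prefix_countE; apply: eq_card => j; rewrite !inE ffunE [fst _]/=.
    have [eq_w|] := eqVneq (z.2 j) (z.2 i); rewrite ?andbT ?andbF //.
    have [lt_ij|lt_ji|eq_ji] := ltngtP j i; last by rewrite (ord_inj eq_ji) ltnn.
      rewrite ltnNge leq_eqVlt; apply/negP => /orP[/eqP|].
        by move/ord_inj/inj_tau=> eq_ij; rewrite eq_ij ltnn in lt_ij.
      by move/(avz _ _ lt_ij); rewrite eq_w ltnn.
    by apply/negP => /(avz _ _ lt_ji); rewrite eq_w ltnn.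
  have eq2 : x.2 = y.2.
    apply/ffunP => v; have : (Phi x v).1 = (Phi y v).1 by rewrite eqPhi.
    by rewrite !ffunE.
  have eq_tau i : tau x i = tau y i.
    apply: (@prefix_count_inj _ _ (fun v => (Phi x v).2)).
      by rewrite Phi_tau eqPhi Phi_tau.
    rewrite Phi_tau {3 4}eqPhi Phi_tau !ffunE /= count_tau //.
    by rewrite count_tau // eqPhi eq2.
  case: x y eq2 eq_tau {avx avy eqPhi} => [s1 w1] [s2 w2] /= -> eq_tau.
  by congr pair; apply/permP => i; apply: rev_ord_inj; apply: eq_tau.
(* It remains to identify the image of [Phi] with the pairs dominated from excess 0. *)
have := card_dominated n 0; rewrite catalan_bin addn0 => <-.
rewrite GRing.natrD GRing.addrK; congr (_%:R)%R.
rewrite -(card_in_imset inj_Phi); apply: eq_card => f; rewrite inE.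
apply/imsetP/andP => [[x + ->]|[/forallP dom /eqP tot]].
  rewrite inE => /avP avx.
  have dom m := @avoid_dominated n (tau x) (fun v => (Phi x v).1)
    (fun v => (Phi x v).2) m (inj_tau x) (Phi_tau x).
  split; first by apply/forallP => m; apply: dom => i j; rewrite !ffunE; apply: avx.
  rewrite (prefix_count_comp _ _ (inj_tau x) (Phi_tau x)) prefix_countE.
  by apply/eqP/eq_card => i; rewrite !inE !ltn_ord.
have [|//|s [inj_s us avs]] := @dominated_ex n (fun v => (f v).1) (fun v => (f v).2).
  by move=> m le_m; have := dom (Ordinal (le_m : m < n.+1)).
have inj_r : injective (fun i => rev_ord (s i)) by move=> i j /rev_ord_inj /inj_s.
(* Reversing the values of [s] makes [tau x] equal to [s]. *)
pose x : C2wrS n := (perm inj_r, [ffun i => (f i).1]).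
have tau_x i : tau x i = s i by rewrite /tau permE rev_ordK.
exists x.
  by rewrite inE; apply/avP => i j; rewrite !tau_x !ffunE; apply: avs.
apply/ffunP => v; have [t st ts] := injF_bij inj_s.
rewrite -[v]ts; move: (t v) => i.
have Phi_s : (Phi x (s i)).2 = (f (s i)).2 by rewrite -tau_x Phi_tau tau_x us !ffunE.
by rewrite [LHS]surjective_pairing -Phi_s [RHS]surjective_pairing !ffunE.
Qed.
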